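(* Let $\mathcal{V}$ be a coextensive variety. Then for every $\mathbf{A}\in\mathcal{V}$ there is a bijection between the set $Z(\mathbf{A})$ of central elements of $\mathbf{A}$ and the set $\mathcal{V}(\mathbf{0}\times\mathbf{0},\mathbf{A})$ of homomorphisms $\mathbf{0}\times\mathbf{0}\to\mathbf{A}$. Moreover, this bijection is natural in $\mathbf{A}$, i.e. it gives a natural isomorphism of functors $\mathcal{V}\to\mathsf{Set}$ between the central-elements functor $Z$ and the representable functor $\mathcal{V}(\mathbf{0}\times\mathbf{0},-)$.
   Context: All varieties are assumed to have at least one constant symbol in their language. A variety $\mathcal{V}$ is also regarded as the category of its algebras and homomorphisms; $\mathbf{0}$ is its initial algebra. A category $\mathsf{C}$ with finite coproducts is extensive if for all objects $X,Y$ the canonical functor $+:\mathsf{C}/X\times\mathsf{C}/Y\to\mathsf{C}/(X+Y)$ is an equivalence; a category is coextensive if its opposite is extensive; a variety is coextensive if it is coextensive as a category. It is known that every coextensive variety is a Pierce variety: there are $N\ge 1$, $0$-ary terms $0_1,\dots,0_N,1_1,\dots,1_N$ and a term $U(x,y,\vec z,\vec w)$ (with $\vec z,\vec w$ of length $N$) such that $U(x,y,\vec 0,\vec 1)=x$ and $U(x,y,\vec 1,\vec 0)=y$ hold in $\mathcal{V}$, where $\vec 0=(0_1,\dots,0_N)$ and $\vec 1=(1_1,\dots,1_N)$. Such data are fixed. For $\vec a\in A^N$, $\vec b\in B^N$ write $[\vec a,\vec b]=((a_1,b_1),\dots,(a_N,b_N))\in(A\times B)^N$. An element $\vec e\in A^N$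 is a central element of $\mathbf{A}$ if there is an isomorphism $\tau:\mathbf{A}\to\mathbf{A}_1\times\mathbf{A}_2$ with $\tau(\vec e)=[\vec 0_{\mathbf{A}_1},\vec 1_{\mathbf{A}_2}]$ (where $\tau$ is applied coordinatewise). $Z(\mathbf{A})$ is the set of central elements of $\mathbf{A}$. In a coextensive variety every homomorphism $f:\mathbf{A}\to\mathbf{B}$, applied coordinatewise, maps $Z(\mathbf{A})$ into $Z(\mathbf{B})$, so $\mathbf{A}\mapsto Z(\mathbf{A})$, $f\mapsto f|_{Z(\mathbf{A})}$ is a functor $Z:\mathcal{V}\to\mathsf{Set}$ (the central-elements functor). *)

(* Defs.v *)
#[warnings="-notation-overridden"]
From mathcomp Require Import all_boot.
From mathcomp Require Import boolp.

Set Implicit Arguments.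
Unset Strict Implicit.
Unset Printing Implicit Defensive.

Record category := Category {
  obj :> Type;
  arrow : obj -> obj -> Type;
  idm : forall a, arrow a a;
  compm : forall a b c, arrow b c -> arrow a b -> arrow a c;
  comp1m : forall a b (f : arrow a b), compm (idm b) f = f;
  compm1 : forall a b (f : arrow a b), compm f (idm a) = f;
  compmA : forall a b c d (h : arrow c d) (g : arrow b c) (f : arrow a b),
    compm h (compm g f) = compm (compm h g) f
}.

Arguments arrow {_} _ _.
Arguments idm {_} _.
Arguments compm {_ _ _ _} _ _.

Notation "a ~> b" := (arrow a b) (at level 55, no associativity).
Notation "g \oc f" := (compm g f) (at level 50, left associativity).

Definition is_iso (C : category) (a b : C) (f : a ~> b) : Prop :=
  exists g : b ~> a, g \oc f = idm a /\ f \oc g = idm b.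

Definition is_initial (C : category) (a : C) : Prop :=
  forall b : C, exists f : a ~> b, forall g : a ~> b, g = f.

Definition opposite (C : category) : category :=
  @Category C (fun a b => b ~> a) (fun a => idm a) (fun _ _ _ g f => f \oc g)
    (fun _ _ f => compm1 f) (fun _ _ f => comp1m f)
    (fun _ _ _ _ h g f => esym (compmA f g h)).

(* Sets are the types of a fixed universe, with Leibniz equality. *)
Definition Sets : category :=
  @Category Type (fun A B => A -> B) (fun _ x => x) (fun _ _ _ g f x => g (f x))
    (fun _ _ _ => erefl) (fun _ _ _ => erefl) (fun _ _ _ _ _ _ _ => erefl).

Definition product_category (C D : category) : category.
Proof.
refine (@Category (C * D)%type
  (fun p q => ((p.1 ~> q.1) * (p.2 ~> q.2))%type)
  (fun p => (idm p.1, idm p.2))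
  (fun _ _ _ g f => (g.1 \oc f.1, g.2 \oc f.2)) _ _ _).
- by move=> p q [f g]; rewrite /= !comp1m.
- by move=> p q [f g]; rewrite /= !compm1.
- by move=> p q r s h g f; rewrite /= !compmA.
Defined.

Record slice_obj (C : category) (x : C) := SliceObj {
  slice_dom : C;
  slice_map : slice_dom ~> x
}.

Definition slice_arrow (C : category) (x : C) (p q : slice_obj x) : Type :=
  {h : slice_dom p ~> slice_dom q | slice_map q \oc h = slice_map p}.

Lemma slice_arrow_eq (C : category) (x : C) (p q : slice_obj x)
  (f g : slice_arrow p q) : sval f = sval g -> f = g.
Proof. by case: f g => [f pf] [g pg] /= fg; apply: eq_exist. Qed.

Definition slice_id (C : category) (x : C) (p : slice_obj x) :
  slice_arrow p p := exist _ (idm (slice_dom p)) (compm1 _).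

Definition slice_comp (C : category) (x : C) (p q r : slice_obj x)
  (g : slice_arrow q r) (f : slice_arrow p q) : slice_arrow p r.
Proof.
exists (sval g \oc sval f).
by rewrite compmA (svalP g) (svalP f).
Defined.

Definition slice (C : category) (x : C) : category.
Proof.
refine (@Category (slice_obj x) (@slice_arrow C x) (@slice_id C x)
  (@slice_comp C x) _ _ _).
- by move=> p q f; apply: slice_arrow_eq; apply: comp1m.
- by move=> p q f; apply: slice_arrow_eq; apply: compm1.
- by move=> p q r s h g f; apply: slice_arrow_eq; apply: compmA.
Defined.

Record functor (C D : category) := Functor {
  fobj :> C -> D;
  fmap : forall a b : C, (a ~> b) -> (fobj a ~> fobj b);
  fmap_id : forall a, fmap (idm a) = idm (fobj a);
  fmap_comp : forall (a b c : C) (g : b ~> c) (f : a ~> b),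
    fmap (g \oc f) = fmap g \oc fmap f
}.

Arguments fmap {_ _} _ {_ _} _.

Definition id_functor (C : category) : functor C C :=
  @Functor C C (fun a => a) (fun _ _ f => f) (fun _ => erefl)
    (fun _ _ _ _ _ => erefl).

Definition comp_functor (C D E : category) (G : functor D E) (F : functor C D) :
  functor C E.
Proof.
refine (@Functor C E (fun a => G (F a)) (fun _ _ f => fmap G (fmap F f)) _ _).
- by move=> a; rewrite !fmap_id.
- by move=> a b c g f; rewrite !fmap_comp.
Defined.

Record nat_trans (C D : category) (F G : functor C D) := NatTrans {
  component :> forall a : C, F a ~> G a;
  naturality : forall (a b : C) (f : a ~> b),
    component b \oc fmap F f = fmap G f \oc component a
}.

Definition is_nat_iso (C D : category) (F G : functor C D)
  (eta : nat_trans F G) : Prop := forall a : C, is_iso (eta a).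

Definition nat_isomorphic (C D : category) (F G : functor C D) : Prop :=
  exists eta : nat_trans F G, is_nat_iso eta.

Definition is_equivalence (C D : category) (F : functor C D) : Prop :=
  exists G : functor D C,
    nat_isomorphic (comp_functor F G) (id_functor D) /\
    nat_isomorphic (comp_functor G F) (id_functor C).

Definition hom_functor (C : category) (x : C) : functor C Sets.
Proof.
refine (@Functor C Sets (fun a => x ~> a) (fun _ _ f h => f \oc h) _ _).
- by move=> a; apply: funext => h; apply: comp1m.
- by move=> a b c g f; apply: funext => h; rewrite /= compmA.
Defined.

Record finite_coproducts (C : category) := FiniteCoproducts {
  initial_obj : C;
  initial_objP : is_initial initial_obj;
  coprod : C -> C -> C;
  inj1 : forall a b, a ~> coprod a b;
  inj2 : forall a b, b ~> coprod a b;
  copair : forall a b c : C, (a ~> c) -> (b ~> c) -> (coprod a b ~> c);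
  copair_inj1 : forall (a b c : C) (f : a ~> c) (g : b ~> c),
    copair f g \oc inj1 a b = f;
  copair_inj2 : forall (a b c : C) (f : a ~> c) (g : b ~> c),
    copair f g \oc inj2 a b = g;
  copair_unique : forall (a b c : C) (h : coprod a b ~> c),
    h = copair (h \oc inj1 a b) (h \oc inj2 a b)
}.

Section Coproduct.

Variables (C : category) (P : finite_coproducts C).

Lemma coprod_ext (a b c : C) (h k : coprod P a b ~> c) :
  h \oc inj1 P a b = k \oc inj1 P a b ->
  h \oc inj2 P a b = k \oc inj2 P a b -> h = k.
Proof.
by move=> h1 h2; rewrite (copair_unique h) (copair_unique k) h1 h2.
Qed.

Definition coprod_map (a b c d : C) (f : a ~> c) (g : b ~> d) :
  coprod P a b ~> coprod P c d :=
  copair P (inj1 P c d \oc f) (inj2 P c d \oc g).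

Lemma coprod_map_id (a b : C) : coprod_map (idm a) (idm b) = idm _.
Proof.
by apply: coprod_ext; rewrite ?(copair_inj1, copair_inj2) compm1 comp1m.
Qed.

Lemma coprod_map_comp (a b c a' b' c' : C) (g : b ~> c) (f : a ~> b)
  (g' : b' ~> c') (f' : a' ~> b') :
  coprod_map (g \oc f) (g' \oc f') = coprod_map g g' \oc coprod_map f f'.
Proof.
apply: coprod_ext.
  by rewrite copair_inj1 -compmA copair_inj1 !compmA copair_inj1.
by rewrite copair_inj2 -compmA copair_inj2 !compmA copair_inj2.
Qed.

Variables x y : C.

Definition plus_obj (p : product_category (slice x) (slice y)) :
  slice (coprod P x y) :=
  SliceObj (coprod_map (slice_map p.1) (slice_map p.2)).

Definition plus_arrow (p q : product_category (slice x) (slice y))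
  (f : p ~> q) : plus_obj p ~> plus_obj q.
Proof.
exists (coprod_map (sval f.1) (sval f.2)).
by rewrite -coprod_map_comp (svalP f.1) (svalP f.2).
Defined.

Definition plus_functor :
  functor (product_category (slice x) (slice y)) (slice (coprod P x y)).
Proof.
refine (@Functor _ _ plus_obj plus_arrow _ _).
- by move=> p; apply: slice_arrow_eq; apply: coprod_map_id.
- by move=> p q r g f; apply: slice_arrow_eq; apply: coprod_map_comp.
Defined.

End Coproduct.

Definition extensive (C : category) (P : finite_coproducts C) : Prop :=
  forall x y : C, is_equivalence (plus_functor P x y).

Record signature := Signature {
  symbol : Type;
  arity : symbol -> nat
}.

Inductive term (S : signature) (X : Type) : Type :=
| Var of X
| App (f : symbol S) of ('I_(arity f) -> term S X).

Arguments Var {S X} _.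
Arguments App {S X} _ _.

Record algebra (S : signature) := Algebra {
  carrier :> Type;
  interp : forall f : symbol S, ('I_(arity f) -> carrier) -> carrier
}.

Arguments interp {S} _ _ _.

Fixpoint eval (S : signature) (X : Type) (A : algebra S) (rho : X -> A)
  (t : term S X) : A :=
  match t with
  | Var x => rho x
  | App f ts => interp A f (fun i => eval rho (ts i))
  end.

Definition is_morphism (S : signature) (A B : algebra S) (h : A -> B) : Prop :=
  forall (f : symbol S) (a : 'I_(arity f) -> A),
    h (interp A f a) = interp B f (fun i => h (a i)).

Lemma eval_morphism (S : signature) (X : Type) (A B : algebra S) (h : A -> B)
  (rho : X -> A) (t : term S X) : is_morphism h ->
  h (eval rho t) = eval (fun x => h (rho x)) t.
Proof.
move=> hM; elim: t => [x|f ts IH] //=.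
by rewrite hM; congr (interp _ _ _); apply: funext => i.
Qed.

(* An equational presentation: identities are pairs of terms in the variables
   indexed by nat, and the members of the variety are the [model]s below. *)
Record variety := Variety {
  sig : signature;
  identities : term sig nat -> term sig nat -> Prop;
  has_constant : exists c : symbol sig, arity c = 0
}.

Definition satisfies (V : variety) (A : algebra (sig V)) : Prop :=
  forall s t : term (sig V) nat, identities s t ->
  forall rho : nat -> A, eval rho s = eval rho t.

Record model (V : variety) := Model {
  model_alg :> algebra (sig V);
  modelP : satisfies model_alg
}.

Record morphism (S : signature) (A B : algebra S) := Morphism {
  mfun :> A -> B;
  morphismP : is_morphism mfun
}.

Lemma morphism_eq (S : signature) (A B : algebra S) (f g : morphism A B) :
  f =1 g -> f = g.
Proof.
case: f g => [f pf] [g pg] /= /funext fg; rewrite fg in pf *.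
by congr Morphism; apply: Prop_irrelevance.
Qed.

Definition morphism_id (S : signature) (A : algebra S) : morphism A A :=
  @Morphism S A A (fun x => x) (fun _ _ => erefl).

Definition morphism_comp (S : signature) (A B C : algebra S)
  (g : morphism B C) (f : morphism A B) : morphism A C.
Proof.
exists (fun x => g (f x)).
by move=> s a; rewrite !morphismP.
Defined.

Definition variety_category (V : variety) : category.
Proof.
refine (@Category (model V) (fun A B => morphism A B)
  (fun A => morphism_id A) (fun _ _ _ g f => morphism_comp g f) _ _ _);
  by move=> *; apply: morphism_eq.
Defined.

Coercion variety_category : variety >-> category.

Definition trivial_algebra (S : signature) : algebra S :=
  @Algebra S unit (fun _ _ => tt).

Lemma trivialP (V : variety) : satisfies (trivial_algebra (sig V)).
Proof. by move=> s t _ rho; case: (eval rho s); case: (eval rho t). Qed.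

Definition trivial_model (V : variety) : model V := Model (@trivialP V).

Definition product_algebra (S : signature) (A B : algebra S) : algebra S :=
  @Algebra S (A * B)%type
    (fun f a => (interp A f (fun i => (a i).1), interp B f (fun i => (a i).2))).

Definition proj1m (S : signature) (A B : algebra S) :
  morphism (product_algebra A B) A :=
  @Morphism S (product_algebra A B) A (fun p => p.1) (fun _ _ => erefl).

Definition proj2m (S : signature) (A B : algebra S) :
  morphism (product_algebra A B) B :=
  @Morphism S (product_algebra A B) B (fun p => p.2) (fun _ _ => erefl).

Lemma productP (V : variety) (A B : model V) :
  satisfies (product_algebra A B).
Proof.
move=> s t st rho; apply: injective_projections.
  have E u := eval_morphism rho u (morphismP (proj1m A B)).
  by rewrite /= in E; rewrite !E; apply: (modelP st).
have E u := eval_morphism rho u (morphismP (proj2m A B)).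
by rewrite /= in E; rewrite !E; apply: (modelP st).
Qed.

Definition product_model (V : variety) (A B : model V) : model V :=
  Model (@productP V A B).

Definition pairm (S : signature) (A B C : algebra S)
  (f : morphism C A) (g : morphism C B) : morphism C (product_algebra A B).
Proof.
exists (fun x => (f x, g x)).
by move=> s a; rewrite !morphismP.
Defined.

(* The direct products of algebras, seen as coproducts in the opposite
   category. *)
Definition variety_products (V : variety) : finite_coproducts (opposite V).
Proof.
refine (@FiniteCoproducts (opposite V) (trivial_model V) _ (@product_model V)
  (fun A B => proj1m A B) (fun A B => proj2m A B)
  (fun _ _ _ f g => pairm f g) _ _ _).
- move=> A; exists (@Morphism _ A (trivial_model V) (fun _ => tt)
    (fun _ _ => erefl)) => g.
  by apply: morphism_eq => x; case: (mfun g x).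
- by move=> *; apply: morphism_eq.
- by move=> *; apply: morphism_eq.
- by move=> A B C h; apply: morphism_eq => x; apply: surjective_pairing.
Defined.

(* Binary coproducts are unique up to isomorphism, so testing extensivity of the
   opposite category on the direct products is no restriction. *)
Definition coextensive (V : variety) : Prop := extensive (variety_products V).

Definition const_val (S : signature) (A : algebra S) (t : term S void) : A :=
  eval (of_void A) t.

Arguments const_val {S} A t.

Lemma const_val_morphism (S : signature) (A B : algebra S) (h : morphism A B)
  (t : term S void) : h (const_val A t) = const_val B t.
Proof.
rewrite /const_val (eval_morphism _ _ (morphismP h)).
by congr eval; apply: funext; case.
Qed.

(* Closed terms modulo equality of their values in all models. *)
Section Initial.

Variable V : variety.

Definition closed_equiv (s t : term (sig V) void) : Prop :=
  forall A : model V, const_val A s = const_val A t.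

Definition term_class : Type :=
  {K : term (sig V) void -> Prop | exists t, K = closed_equiv t}.

Definition class_of (t : term (sig V) void) : term_class :=
  exist _ (closed_equiv t) (ex_intro _ t erefl).

Definition repr_of (k : term_class) : term (sig V) void :=
  projT1 (cid (svalP k)).

Lemma repr_ofK (k : term_class) : class_of (repr_of k) = k.
Proof.
rewrite /repr_of; case: cid => t /=.
by case: k => K hK /= e; apply: eq_exist.
Qed.

Lemma class_ofP (s t : term (sig V) void) :
  class_of s = class_of t <-> closed_equiv s t.
Proof.
split=> [[E]|E]; first by rewrite E.
apply: eq_exist; apply: funext => r; apply: propext.
by split=> F A; [rewrite -E F | rewrite E F].
Qed.

Definition initial_algebra : algebra (sig V) :=
  @Algebra (sig V) term_class
    (fun f a => class_of (App f (fun i => repr_of (a i)))).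

Fixpoint bind_term (X : Type) (r : X -> term (sig V) void)
  (t : term (sig V) X) : term (sig V) void :=
  match t with
  | Var x => r x
  | App f ts => App f (fun i => bind_term r (ts i))
  end.

Lemma const_val_bind (X : Type) (r : X -> term (sig V) void)
  (t : term (sig V) X) (A : model V) :
  const_val A (bind_term r t) = eval (fun x => const_val A (r x)) t.
Proof.
elim: t => [x|f ts IH] //=; rewrite /const_val /=.
by congr (interp _ _ _); apply: funext => i; apply: IH.
Qed.

Lemma class_of_eval (X : Type) (rho : X -> initial_algebra)
  (t : term (sig V) X) :
  eval rho t = class_of (bind_term (fun x => repr_of (rho x)) t).
Proof.
elim: t => [x|f ts IH] /=; first by rewrite repr_ofK.
apply/class_ofP => A; rewrite /const_val /=.
congr (interp _ _ _); apply: funext => i.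
by move: A; apply/class_ofP; rewrite repr_ofK IH.
Qed.

Lemma initial_algebraP : satisfies initial_algebra.
Proof.
move=> s t st rho; rewrite !class_of_eval; apply/class_ofP => A.
by rewrite !const_val_bind; apply: (modelP st).
Qed.

Definition initial_model : model V := Model initial_algebraP.

Lemma initial_modelP : @is_initial V initial_model.
Proof.
move=> A.
have hM : @is_morphism _ initial_algebra A (fun k => const_val A (repr_of k)).
  move=> f a.
  have /class_ofP -> :
      class_of (repr_of (interp initial_algebra f a)) =
      class_of (App f (fun i => repr_of (a i))) by rewrite repr_ofK.
  by [].
exists (Morphism hM) => g; apply: morphism_eq => k /=.
rewrite -(const_val_morphism g); congr (mfun g _).
rewrite -[LHS]repr_ofK /const_val class_of_eval.
apply/class_ofP => B; rewrite const_val_bind /const_val.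
by congr eval; apply: funext; case.
Qed.

End Initial.

(* The variables x, y, z_i, w_i of the term U. *)
Inductive pierce_var (N : nat) : Type :=
| VX
| VY
| VZ of 'I_N
| VW of 'I_N.

Definition pierce_env (N : nat) (T : Type) (x y : T) (z w : 'I_N -> T)
  (v : pierce_var N) : T :=
  match v with VX => x | VY => y | VZ i => z i | VW i => w i end.

Record pierce (V : variety) := Pierce {
  pdim : nat;
  pdim_gt0 : 0 < pdim;
  zeros : 'I_pdim -> term (sig V) void;
  ones : 'I_pdim -> term (sig V) void;
  pterm : term (sig V) (pierce_var pdim);
  pterm01 : forall (A : model V) (x y : A),
    eval (pierce_env x y (fun i => const_val A (zeros i))
                         (fun i => const_val A (ones i))) pterm = x;
  pterm10 : forall (A : model V) (x y : A),
    eval (pierce_env x y (fun i => const_val A (ones i))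
                         (fun i => const_val A (zeros i))) pterm = y
}.

Arguments zeros {V} p i.
Arguments ones {V} p i.

Definition is_central (V : variety) (P : pierce V) (A : model V)
  (e : 'I_(pdim P) -> A) : Prop :=
  exists (A1 A2 : V) (tau : (A : V) ~> product_model A1 A2),
    is_iso tau /\
    forall i, mfun tau (e i) =
              (const_val A1 (zeros P i), const_val A2 (ones P i)).

Arguments is_central {V} P {A} e.

Definition central (V : variety) (P : pierce V) (A : model V) : Type :=
  {e : 'I_(pdim P) -> A | is_central P e}.

Lemma central_morphism (V : variety) (P : pierce V) (A B : model V)
  (f : morphism A B) (e : 'I_(pdim P) -> A) :
  coextensive V -> is_central P e -> is_central P (fun i => f (e i)).
Proof.
move=> hV [A1 [A2 [tau [[sigma [st ts]] tau_e]]]].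
have [G [[eta eta_iso] _]] := hV A1 A2.
pose d : slice (coprod (variety_products V) A1 A2) :=
  @SliceObj (opposite V) (product_model A1 A2) B
    (@compm V _ _ _ (f : (A : V) ~> B) sigma).
have [u [u1 u2]] := eta_iso d.
pose B1 : V := slice_dom (G d).1; pose B2 : V := slice_dom (G d).2.
pose b1 : A1 ~> B1 := slice_map (G d).1; pose b2 : A2 ~> B2 := slice_map (G d).2.
pose h : (B : V) ~> product_model B1 B2 := sval (eta d).
have comm : h \oc ((f : (A : V) ~> B) \oc sigma) =
  @coprod_map _ (variety_products V) B1 B2 A1 A2 b1 b2 := svalP (eta d).
exists B1, B2, h; split.
  by exists (sval u); split; [exact: (congr1 sval u2) | exact: (congr1 sval u1)].
move=> i.
have fe : f (e i) = f (mfun sigma (mfun tau (e i))).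
  by congr (f _); rewrite -[LHS](congr1 (fun k : morphism A A => k (e i)) st).
have hfe x : mfun h (f (mfun sigma x)) = (mfun b1 x.1, mfun b2 x.2).
  exact: (congr1 (fun k : morphism (product_model A1 A2) _ => k x) comm).
by rewrite fe hfe tau_e /= (const_val_morphism b1) (const_val_morphism b2).
Qed.

Definition central_functor (V : variety) (P : pierce V) (hV : coextensive V) :
  functor V Sets.
Proof.
refine (@Functor V Sets (central P)
  (fun A B f e => exist _ (fun i => mfun f (sval e i))
                          (central_morphism f hV (svalP e))) _ _).
- by move=> A; apply: funext => -[e he]; apply: eq_exist.
- by move=> A B C g f; apply: funext => e; apply: eq_exist.
Defined.

(* Main.v *)
Require Import Defs.
From mathcomp Require Import all_boot.
From mathcomp Require Import boolp.

(** Write [0,1] for the tuple of pairs (0_i, 1_i) in O x O, where O is the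
    initial algebra; it is central there, as the identity of O x O shows.
    Homomorphisms preserve central elements, so evaluation at [0,1] sends a
    homomorphism h : O x O -> A to a central element of A, naturally in A.
    The bijection of the theorem is the inverse of this evaluation, and its
    naturality is inherited.

    Evaluation is surjective ([eval01_surj]): if tau : A -> A1 x A2 is an
    isomorphism with tau(e) = [0,1], then the product O x O -> A1 x A2 of the
    two initial maps, followed by the inverse of tau, takes [0,1] to e.

    It is injective ([eval01_inj]) because in a coextensive variety two
    direct decompositions of an algebra have a common refinement.  Let h and k
    agree on [0,1].  By coextensivity h and k are, up to isomorphism, products
    of two maps; this gives decompositions A = B1 x B2 and A = C1 x C2, and
    cutting each Cj along the first decomposition embeds A into the product of
    four quotients Dij, each of them a common quotient of Bi and Cj.  Followed
    by A -> Dij, the map h factors through the i-th projection of O x O, and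
    the map k through the j-th one.  On D11 and D22 the two composites are
    equal because O is initial.  On D12 and D21 one of them sends [0,1] to the
    tuple of zeros and the other to the tuple of ones; these tuples are then
    equal in Dij, so the term U makes Dij trivial ([zeros_ones_trivial]). *)

Set Implicit Arguments.
Unset Strict Implicit.
Unset Printing Implicit Defensive.

(** The part of coextensivity that is used: essential surjectivity of the
    functor sum on slices, read in the opposite category. *)
Lemma coextensive_split (V : variety) (A1 A2 B : model V)
    (f : morphism (product_model A1 A2) B) :
  coextensive V ->
  exists (B1 B2 : model V) (p1 : morphism B B1) (p2 : morphism B B2)
         (b1 : morphism A1 B1) (b2 : morphism A2 B2),
    [/\ @is_iso V B (product_model B1 B2) (pairm p1 p2),
        forall x, p1 (f x) = b1 x.1 & forall x, p2 (f x) = b2 x.2].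
Proof.
move=> hV.
have [G [[eta eta_iso] _]] := hV A1 A2.
pose d : slice (coprod (variety_products V) A1 A2) :=
  @SliceObj (opposite V) (product_model A1 A2) B f.
have [u [u1 u2]] := eta_iso d.
pose B1 : model V := slice_dom (G d).1; pose B2 : model V := slice_dom (G d).2.
pose h : morphism B (product_model B1 B2) := sval (eta d).
have comm := svalP (eta d).
have hfE x : h (f x) = (mfun (slice_map (G d).1) x.1,
                        mfun (slice_map (G d).2) x.2).
  exact: (congr1 (fun k : morphism (product_model A1 A2) _ => k x) comm).
exists B1, B2, (morphism_comp (proj1m B1 B2) h), (morphism_comp (proj2m B1 B2) h),
  (slice_map (G d).1), (slice_map (G d).2).
split=> [|x|x]; try by rewrite /= hfE.
have -> : pairm (morphism_comp (proj1m B1 B2) h) (morphism_comp (proj2m B1 B2) h)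
          = h by apply: morphism_eq => x /=; case: (h x).
by exists (sval u); split; [exact: (congr1 sval u2) | exact: (congr1 sval u1)].
Qed.

Lemma initial_eq (V : variety) (O A : model V) (f g : morphism O A) :
  @is_initial V O -> f = g.
Proof. by move=> /(_ A) [h hh]; rewrite (hh f) (hh g). Qed.

Lemma pair_iso_inj (V : variety) (A A1 A2 : model V)
    (p1 : morphism A A1) (p2 : morphism A A2) :
  @is_iso V A (product_model A1 A2) (pairm p1 p2) ->
  forall x y, p1 x = p1 y -> p2 x = p2 y -> x = y.
Proof.
move=> [s [sp _]] x y e1 e2.
have spE a : mfun s (p1 a, p2 a) = a :=
  congr1 (fun m : morphism A A => m a) sp.
by rewrite -(spE x) -(spE y) e1 e2.
Qed.

(** When zeros and ones coincide, the two identities of the term U become two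
    values of one and the same expression. *)
Lemma zeros_ones_trivial (V : variety) (P : pierce V) (A : model V) :
  (forall i, const_val A (zeros P i) = const_val A (ones P i)) ->
  forall x y : A, x = y.
Proof.
move=> /funext E x y; rewrite -[x in LHS](pterm01 P x y).
by rewrite -[RHS](pterm10 P x y) E.
Qed.

Definition zero_one (V : variety) (P : pierce V) (A1 A2 : model V)
    (i : 'I_(pdim P)) : product_model A1 A2 :=
  (const_val A1 (zeros P i), const_val A2 (ones P i)).

Arguments zero_one {V} P A1 A2 i.

Lemma zero_one_central (V : variety) (P : pierce V) (A1 A2 : model V) :
  is_central P (zero_one P A1 A2).
Proof.
exists A1, A2, (idm (product_model A1 A2 : V)); split=> //.
by exists (idm _); rewrite comp1m.
Qed.

Section Evaluation.

Variables (V : variety) (P : pierce V) (hV : coextensive V).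
Variables (O : model V) (hO : @is_initial V O).

Definition eval01 (A : model V) (h : morphism (product_model O O) A) :
  central P A := exist _ _ (central_morphism h hV (zero_one_central P O O)).

Lemma eval01_natural (A B : model V) (f : morphism A B)
    (h : morphism (product_model O O) A) :
  eval01 (morphism_comp f h) = fmap (central_functor P hV) f (eval01 h).
Proof. exact: eq_exist. Qed.

Lemma eval01_surj (A : model V) (e : central P A) :
  exists h : morphism (product_model O O) A, eval01 h = e.
Proof.
case: e => e he.
have [A1 [A2 [tau [[sigma [st _]] tau_e]]]] := he.
have [f1 _] := hO A1; have [f2 _] := hO A2.
pose prod_map := pairm (morphism_comp f1 (proj1m O O))
                       (morphism_comp f2 (proj2m O O)).
exists (morphism_comp (sigma : morphism (product_model A1 A2) A) prod_map).
apply: eq_exist; apply: funext => i /=.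
rewrite (const_val_morphism f1) (const_val_morphism f2) -tau_e.
exact: (congr1 (fun k : morphism A A => k (e i)) st).
Qed.

(** This disposes of the off-diagonal blocks of a common refinement, where two
    maps that agree on [0,1] factor through different projections of O x O. *)
Lemma zero_one_cross_trivial (D : model V) (u v : morphism O D) :
  (forall i, u (zero_one P O O i).1 = v (zero_one P O O i).2) ->
  forall x y : D, x = y.
Proof.
move=> uv; apply: (@zeros_ones_trivial V P) => i.
by have := uv i; rewrite /= !const_val_morphism.
Qed.

Lemma eval01_inj (A : model V) : injective (@eval01 A).
Proof.
move=> h k /(congr1 sval) /= hk.
have {}hk i : h (zero_one P O O i) = k (zero_one P O O i).
  exact: (congr1 (fun e => e i) hk).
have [B1 [B2 [p1 [p2 [b1 [b2 [p_iso hb1 hb2]]]]]]] := coextensive_split h hV.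
have [C1 [C2 [q1 [q2 [c1 [c2 [q_iso kc1 kc2]]]]]]] := coextensive_split k hV.
have [s0 [sp _]] := p_iso; pose s : morphism (product_model B1 B2) A := s0.
have {}sp a : s (p1 a, p2 a) = a := congr1 (fun m : morphism A A => m a) sp.
(* Dij is the block of Cj cut out by the i-th factor of A = B1 x B2. *)
have [D11 [D21 [r11 [r21 [d11 [d21 [r1_iso rd11 rd21]]]]]]] :=
  coextensive_split (morphism_comp q1 s) hV.
have [D12 [D22 [r12 [r22 [d12 [d22 [r2_iso rd12 rd22]]]]]]] :=
  coextensive_split (morphism_comp q2 s) hV.
have {}rd11 a : r11 (q1 a) = d11 (p1 a) by rewrite -(rd11 (p1 a, p2 a)) /= sp.
have {}rd21 a : r21 (q1 a) = d21 (p2 a) by rewrite -(rd21 (p1 a, p2 a)) /= sp.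
have {}rd12 a : r12 (q2 a) = d12 (p1 a) by rewrite -(rd12 (p1 a, p2 a)) /= sp.
have {}rd22 a : r22 (q2 a) = d22 (p2 a) by rewrite -(rd22 (p1 a, p2 a)) /= sp.
apply: morphism_eq => x.
apply: (pair_iso_inj q_iso); [apply: (pair_iso_inj r1_iso) |
  apply: (pair_iso_inj r2_iso)].
(* On the diagonal both sides are composites O x O -> O -> Dii. *)
- rewrite rd11 hb1 kc1.
  by have /(congr1 (fun m : morphism O D11 => m x.1)) :=
    initial_eq (morphism_comp d11 b1) (morphism_comp r11 c1) hO.
(* Off the diagonal Dij has at most one element, because h and k agree on
   [0,1]. *)
- apply: (@zero_one_cross_trivial D21 (morphism_comp r21 c1)
           (morphism_comp d21 b2)) => i.
  by rewrite /= -(kc1 (zero_one P O O i)) -hk rd21 hb2.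
- apply: (@zero_one_cross_trivial D12 (morphism_comp d12 b1)
           (morphism_comp r12 c2)) => i.
  by rewrite /= -(kc2 (zero_one P O O i)) -hk rd12 hb1.
- rewrite rd22 hb2 kc2.
  by have /(congr1 (fun m : morphism O D22 => m x.2)) :=
    initial_eq (morphism_comp d22 b2) (morphism_comp r22 c2) hO.
Qed.

End Evaluation.

Theorem theorem3p5 (V : variety) (P : pierce V) (hV : coextensive V)
    (O : model V) (hO : @is_initial V O) :
  exists eta : nat_trans (central_functor P hV)
                         (@hom_functor V (product_model O O)),
    (forall A : model V,
       bijective (eta A : central P A -> morphism (product_model O O) A)) /\
    is_nat_iso eta.
Proof.
pose phi (A : model V) (e : central P A) : morphism (product_model O O) A :=
  projT1 (cid (eval01_surj hV hO e)).
have phiK (A : model V) : cancel (@phi A) (@eval01 V P hV O A).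
  by move=> e; exact: projT2 (cid (eval01_surj hV hO e)).
have evalK (A : model V) : cancel (@eval01 V P hV O A) (@phi A).
  by move=> h; apply: (@eval01_inj V P hV O hO); exact: phiK.
have phi_natural (A B : V) (f : A ~> B) :
    @compm Sets _ _ _ (@phi B) (fmap (central_functor P hV) f) =
    @compm Sets _ _ _ (fmap (@hom_functor V (product_model O O)) f) (@phi A).
  apply: funext => e; apply: (@eval01_inj V P hV O hO) => /=.
  rewrite [LHS]phiK [RHS](eval01_natural P hV f (phi A e)).
  by rewrite phiK.
exists (@NatTrans V Sets (central_functor P hV)
          (@hom_functor V (product_model O O)) phi phi_natural).
split=> A; exists (@eval01 V P hV O A) => //.
by split; apply: funext; [exact: phiK | exact: evalK].
Qed.
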